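(* Let $\Omega$ be a simply connected domain containing $\mathbb{D}$, let $\lambda=\lambda(\Omega)$ be as defined in the context (assumed finite and positive), and let $m\ge1$ and $$P(w)=\sum_{j=1}^m k_jw^j,\qquad k_j=\left(\frac{1+\lambda}{1+2\lambda}\right)^{2j}.$$ If $f\in\mathcal{B}(\Omega)$ with $f(z)=\sum_{n=0}^\infty a_nz^n$ for $z\in\mathbb{D}$, then $$\sum_{n=0}^\infty|a_n|r^n+P\!\left(\frac{S_r}{\pi}\right)\le 1\quad\text{for } 0<r\le\frac{1}{1+2\lambda},$$ where $S_r$ is the area of the image of the disk $\{|z|<r\}$ under $f$. Equality at $r=1/(1+2\lambda)$ can only occur when $f$ is a unimodular constant.
   Context: $\mathbb{D}$ is the open unit disk; $\mathcal{B}(\Omega)$ is the class of analytic $f$ on $\Omega$ with $|f|<1$ on $\Omega$. $\lambda(\Omega)=\sup\{|a_n|/(1-|a_0|^2): n\ge1,\ f\in\mathcal{B}(\Omega)\text{ nonconstant},\ f(z)=\sum a_nz^n \text{ on }\mathbb{D}\}$, so that $|a_n|\le\lambda(1-|a_0|^2)$ for all $n\ge1$ and all $f\in\mathcal{B}(\Omega)$. Area is counted with multiplicity: $S_r=\iint_{|z|<r}|f'(z)|^2\,dx\,dy$. *)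

(* Defs.v *)
From Stdlib Require Import Reals.
From Coquelicot Require Import Coquelicot.
Open Scope R_scope.

Definition cderiv (f : C -> C) (z : C) (l : C) : Prop :=
  @is_derive C_AbsRing C_NormedModule f z l.

Definition analytic_on (Omega : C -> Prop) (f : C -> C) : Prop :=
  forall z, Omega z -> exists l, cderiv f z l.

Definition taylor_on_disk (f : C -> C) (a : nat -> C) : Prop :=
  forall z : C, Cmod z < 1 ->
    @is_pseries C_AbsRing C_NormedModule a z (f z).

Definition connected_set (Omega : C -> Prop) : Prop :=
  forall U V : C -> Prop, @open C_UniformSpace U -> @open C_UniformSpace V ->
    (forall z, Omega z -> U z \/ V z) ->
    (forall z, ~ (Omega z /\ U z /\ V z)) ->
    (forall z, ~ (Omega z /\ U z)) \/ (forall z, ~ (Omega z /\ V z)).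

Definition is_domain (Omega : C -> Prop) : Prop :=
  (exists z, Omega z) /\ @open C_UniformSpace Omega /\ connected_set Omega.

Definition simply_connected (Omega : C -> Prop) : Prop :=
  forall g : R -> C,
    (forall t, 0 <= t <= 1 -> continuous g t /\ Omega (g t)) ->
    g 0 = g 1 ->
    exists (H : R * R -> C) (c : C),
      (forall s t, 0 <= s <= 1 -> 0 <= t <= 1 ->
         continuous H (s, t) /\ Omega (H (s, t))) /\
      (forall t, 0 <= t <= 1 -> H (0, t) = g t /\ H (1, t) = c) /\
      (forall s, 0 <= s <= 1 -> H (s, 0) = H (s, 1)).

Definition in_B (Omega : C -> Prop) (f : C -> C) : Prop :=
  analytic_on Omega f /\ forall z, Omega z -> Cmod (f z) < 1.

Definition nonconstant_on (Omega : C -> Prop) (f : C -> C) : Prop :=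
  exists z w, Omega z /\ Omega w /\ f z <> f w.

Definition lambda_set (Omega : C -> Prop) (t : R) : Prop :=
  exists (g : C -> C) (b : nat -> C) (n : nat),
    in_B Omega g /\ nonconstant_on Omega g /\ taylor_on_disk g b /\
    (1 <= n)%nat /\ t = Cmod (b n) / (1 - (Cmod (b 0%nat))^2).

Definition is_lambda (Omega : C -> Prop) (lam : R) : Prop :=
  is_lub (lambda_set Omega) lam.

Definition Ppoly (lam : R) (m : nat) (w : R) : R :=
  sum_f 1 m (fun j => ((1 + lam) / (1 + 2 * lam)) ^ (2 * j) * w ^ j).

(* S_r = double integral over |z| < r of |f'(z)|^2 dx dy, with df = f' *)
Definition area_S (df : C -> C) (r : R) : R :=
  RInt (fun x =>
    RInt (fun y => (Cmod (df (x, y))) ^ 2)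
         (- sqrt (r ^ 2 - x ^ 2)) (sqrt (r ^ 2 - x ^ 2)))
    (- r) r.

(* Main.v *)
Require Import Defs.
From Stdlib Require Import Reals Lra Lia.
From Coquelicot Require Import Coquelicot.
Open Scope R_scope.

(* Put A = |a_0| < 1 and d = 1 - A^2, so that |a_n| <= lam d for n >= 1.  For
   r <= 1/(1 + 2 lam) the majorant series is at most A + lam d r/(1 - r) <= A + d/2,
   and S_r/pi = sum n |a_n|^2 r^(2n) <= (lam d r/(1 - r^2))^2, so that each k_j (S_r/pi)^j
   is at most (d^2/16)^j.  Summing, P(S_r/pi) <= d^2/15 < (1 - A)^2/2 = 1 - A - d/2; the
   inequality is therefore always strict, and equality never occurs since |f| < 1.

   The area is an iterated Cartesian integral.  The integrals M_jk of z^j zbar^k over the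
   disk are found without polar coordinates: the z- and zbar-derivatives of a polynomial
   multiple of r^2 - |z|^2, which vanishes on the circle, have integral 0, and this gives
   (j+1) r^2 M_jk = (j+2) M_(j+1,k+1) and (k+1) r^2 M_jk = (k+2) M_(j+1,k+1). *)

(** * Integrals over the disk by vertical slices *)

(** The chord length has infinite slope at the two ends of the diameter, so only interior
    differentiability is available there. Since [f] minus the integral of [df] is continuous with
    zero derivative inside, the mean value theorem gives it equal values at [a] and [b]. *)
Lemma is_RInt_derive_interior (f df : R -> R) (a b : R) :
  a < b ->
  (forall x, a < x < b -> is_derive f x (df x)) ->
  (forall x, continuous f x) -> (forall x, continuous df x) ->
  is_RInt df a b (f b - f a).
Proof.
  intros Hab Hd Hf Hdf.
  assert (HI : forall x, is_derive (fun t => RInt df a t) x (df x)).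
  { intros x. apply (is_derive_RInt df (fun t => RInt df a t) a x); [|apply Hdf].
    apply filter_forall. intros t. apply (RInt_correct df).
    apply (ex_RInt_continuous df). intros; apply Hdf. }
  destruct (MVT_gen (fun x => f x - RInt df a x) a b (fun _ => 0)) as [c [_ Hc]].
  - rewrite Rmin_left, Rmax_right by lra. intros x Hx.
    replace 0 with (df x - df x) by ring.
    apply (is_derive_minus f (fun t => RInt df a t)); [apply Hd, Hx | apply HI].
  - intros x _. apply continuity_pt_filterlim.
    apply (continuous_minus f (fun t => RInt df a t)); [apply Hf|].
    apply (ex_derive_continuous (fun t => RInt df a t)). eexists; apply HI.
  - rewrite RInt_point in Hc. unfold zero in Hc; simpl in Hc.
    replace (f b - f a) with (RInt df a b) by lra.
    apply (RInt_correct df). apply (ex_RInt_continuous df). intros; apply Hdf.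
Qed.

Definition chord (r x : R) : R := sqrt (r ^ 2 - x ^ 2).

(** The integral of [area_S] as a relation: the witness [h] carries the existence and the value of
    every slice integral, so integrability travels along with the value through sums and limits. *)
Definition is_disk_int (r : R) (g : R -> R -> R) (v : R) : Prop :=
  exists h : R -> R,
    (forall x, - r <= x <= r -> is_RInt (g x) (- chord r x) (chord r x) (h x)) /\
    is_RInt h (- r) r v.

Lemma chord_ge_0 (r x : R) : 0 <= chord r x.
Proof. apply sqrt_pos. Qed.

Lemma chord_sqr (r x : R) : 0 <= r -> - r <= x <= r -> chord r x ^ 2 = r ^ 2 - x ^ 2.
Proof. intros Hr Hx. unfold chord. rewrite pow2_sqrt; nra. Qed.

Lemma chord_le (r x : R) : 0 <= r -> - r <= x <= r -> chord r x <= r.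
Proof.
  intros Hr Hx. generalize (chord_sqr r x Hr Hx) (chord_ge_0 r x). intros. nra.
Qed.

Lemma chord_in_disk (r x y : R) : 0 <= r -> - r <= x <= r ->
  - chord r x <= y <= chord r x -> Cmod (x, y) <= r.
Proof.
  intros Hr Hx Hy. unfold Cmod; simpl fst; simpl snd.
  rewrite <- (sqrt_pow2 r Hr) at 1. apply sqrt_le_1_alt.
  generalize (chord_sqr r x Hr Hx) (chord_ge_0 r x). intros. nra.
Qed.

Lemma continuous_chord (r x : R) : continuous (chord r) x.
Proof.
  apply (continuous_sqrt_comp (fun x => r ^ 2 - x ^ 2)).
  apply (ex_derive_continuous (fun x => r ^ 2 - x ^ 2)). auto_derive; auto.
Qed.

Lemma is_derive_chord (r x : R) : - r < x < r ->
  is_derive (chord r) x (- x / chord r x).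
Proof.
  intros Hx. unfold chord. assert (0 < r ^ 2 - x ^ 2) by nra.
  auto_derive; [lra|].
  change (r * (r * 1) + - (x * (x * 1))) with (r ^ 2 - x ^ 2). field.
  apply Rgt_not_eq. apply sqrt_lt_R0. lra.
Qed.

Lemma is_disk_int_ext (r : R) (g g' : R -> R -> R) (v v' : R) :
  0 <= r ->
  (forall x y, - r <= x <= r -> - chord r x <= y <= chord r x -> g x y = g' x y) ->
  v = v' -> is_disk_int r g v -> is_disk_int r g' v'.
Proof.
  intros Hr He <- [h [H1 H2]]. exists h; split; [|exact H2].
  intros x Hx. apply (is_RInt_ext (g x)); [|apply H1, Hx].
  generalize (chord_ge_0 r x); intro Hc.
  rewrite Rmin_left, Rmax_right by lra. intros y Hy. apply He; lra.
Qed.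

Lemma is_disk_int_plus (r : R) (g1 g2 : R -> R -> R) (v1 v2 : R) :
  is_disk_int r g1 v1 -> is_disk_int r g2 v2 ->
  is_disk_int r (fun x y => g1 x y + g2 x y) (v1 + v2).
Proof.
  intros [h1 [A1 B1]] [h2 [A2 B2]]. exists (fun x => h1 x + h2 x). split.
  - intros x Hx. apply (is_RInt_plus (g1 x) (g2 x)); auto.
  - apply (is_RInt_plus h1 h2); auto.
Qed.

Lemma is_disk_int_scal (r k : R) (g : R -> R -> R) (v : R) :
  is_disk_int r g v -> is_disk_int r (fun x y => k * g x y) (k * v).
Proof.
  intros [h [A B]]. exists (fun x => k * h x). split.
  - intros x Hx. apply (is_RInt_scal (g x)); auto.
  - apply (is_RInt_scal h); auto.
Qed.

Lemma is_disk_int_area (r : R) (df : C -> C) (v : R) :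
  0 <= r ->
  is_disk_int r (fun x y => Cmod (df (x, y)) ^ 2) v -> area_S df r = v.
Proof.
  intros Hr [h [A B]]. unfold area_S. apply is_RInt_unique.
  apply (is_RInt_ext h); [|exact B].
  rewrite Rmin_left, Rmax_right by lra. intros x Hx.
  symmetry. apply is_RInt_unique. apply A. lra.
Qed.

(** The substitution x = r sin t turns the outer integral into that of 2 r^2 cos^2 t over
    [-pi/2, pi/2], with primitive r^2 (t + sin t cos t). *)
Lemma is_disk_int_one (r : R) : 0 <= r -> is_disk_int r (fun _ _ => 1) (PI * r ^ 2).
Proof.
  intros Hr. exists (fun x => 2 * chord r x). split.
  - intros x _. replace (2 * chord r x) with (scal (chord r x - - chord r x) 1).
    apply (is_RInt_const (V := R_NormedModule)).
    unfold scal; simpl; unfold mult; simpl. ring.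
  - assert (HP := PI_RGT_0).
    assert (Hcont : forall x, continuous (fun x => 2 * chord r x) x).
    { intros x. apply (continuous_scal_r 2 (chord r)). apply continuous_chord. }
    assert (HC : is_RInt (fun t => scal (r * cos t) (2 * chord r (r * sin t)))
              (- (PI / 2)) (PI / 2)
              (RInt (fun x => 2 * chord r x) (r * sin (- (PI/2))) (r * sin (PI/2)))).
    { apply (is_RInt_comp (fun x => 2 * chord r x) (fun t => r * sin t) (fun t => r * cos t)).
      - intros; apply Hcont.
      - intros t _. split.
        + auto_derive; auto. ring.
        + apply (ex_derive_continuous (fun t => r * cos t)). auto_derive; auto. }
    rewrite sin_neg, sin_PI2 in HC.
    replace (r * - (1)) with (- r) in HC by ring. replace (r * 1) with r in HC by ring.
    assert (HD : is_RInt (fun t => scal (r * cos t) (2 * chord r (r * sin t)))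
              (- (PI / 2)) (PI / 2) (PI * r ^ 2)).
    { apply (is_RInt_ext (fun t => 2 * r ^ 2 * cos t ^ 2)).
      - rewrite Rmin_left, Rmax_right by lra. intros t Ht.
        assert (0 <= cos t) by (apply cos_ge_0; lra).
        unfold scal; simpl; unfold mult; simpl. unfold chord.
        replace (r ^ 2 - (r * sin t) ^ 2) with ((r * cos t) ^ 2).
        rewrite sqrt_pow2 by nra. ring.
        generalize (sin2_cos2 t). unfold Rsqr. intros. nra.
      - replace (PI * r ^ 2) with
          (minus ((fun t => r ^ 2 * (t + sin t * cos t)) (PI / 2))
                 ((fun t => r ^ 2 * (t + sin t * cos t)) (- (PI / 2)))).
        apply (is_RInt_derive (fun t => r ^ 2 * (t + sin t * cos t))).
        + intros t _. auto_derive; auto.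
          generalize (sin2_cos2 t). unfold Rsqr. intros. nra.
        + intros t _.
          apply (ex_derive_continuous (fun t => 2 * r ^ 2 * cos t ^ 2)). auto_derive; auto.
        + simpl. rewrite cos_neg, cos_PI2. unfold minus, plus, opp; simpl. field. }
    rewrite <- (is_RInt_unique _ _ _ _ HD), (is_RInt_unique _ _ _ _ HC).
    apply (RInt_correct (fun x => 2 * chord r x)).
    apply (ex_RInt_continuous (fun x => 2 * chord r x)). intros; apply Hcont.
Qed.

(** The integrand is the y-derivative of (r^2 - x^2 - y^2) x^a y^b, which vanishes at both ends of
    each vertical chord; every slice integral is already 0. *)
Lemma is_disk_int_dy_mono (r : R) (a b : nat) :
  0 <= r ->
  is_disk_int r
    (fun x y => - 2 * y * (x ^ a * y ^ b) +
                (r ^ 2 - x ^ 2 - y ^ 2) * (x ^ a * (INR b * y ^ pred b))) 0.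
Proof.
  intros Hr. exists (fun _ => 0). split.
  - intros x Hx.
    set (F := fun y => (r ^ 2 - x ^ 2 - y ^ 2) * (x ^ a * y ^ b)).
    replace 0 with (minus (F (chord r x)) (F (- chord r x))).
    + apply (is_RInt_derive F).
      * intros y _. unfold F. auto_derive; auto. simpl. ring.
      * intros y _. match goal with |- continuous ?f _ => apply (ex_derive_continuous f) end.
        auto_derive; auto.
    + unfold F. replace ((- chord r x) ^ 2) with (chord r x ^ 2) by ring.
      rewrite (chord_sqr r x Hr Hx). unfold minus, plus, opp; simpl. ring.
  - generalize (is_RInt_const (V := R_NormedModule) (- r) r 0).
    now rewrite (@scal_zero_r R_Ring R_ModuleSpace).
Qed.

Lemma is_RInt_pow_sym (s : R) (b : nat) :
  is_RInt (fun y => y ^ b) (- s) s ((1 - (-1) ^ S b) / (INR (S b)) * s ^ S b).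
Proof.
  assert (Hb : INR (S b) <> 0) by (apply not_0_INR; lia).
  replace ((1 - (-1) ^ S b) / (INR (S b)) * s ^ S b) with
   (minus ((fun y => y ^ S b / INR (S b)) s) ((fun y => y ^ S b / INR (S b)) (- s))).
  - apply (is_RInt_derive (fun y => y ^ S b / INR (S b))).
    + intros y _. auto_derive; auto. change (pred (S b)) with b. field. exact Hb.
    + intros y _. apply (ex_derive_continuous (fun y => y ^ b)). auto_derive; auto.
  - cbv beta. replace (- s) with (-1 * s) by ring. rewrite Rpow_mult_distr.
    unfold minus, plus, opp; cbn -[pow INR]. field. exact Hb.
Qed.

(** The integrand is the x-derivative of the same product, but the slices run in y and need not
    vanish one by one. Instead the slice integral is the derivative of H(x), the integral of (r^2 -
    x^2 - y^2) x^a y^b over the chord at x, and H vanishes at x = r and x = -r, where the chord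
    degenerates. *)
Lemma is_disk_int_dx_mono (r : R) (a b : nat) :
  0 < r ->
  is_disk_int r
    (fun x y => - 2 * x * (x ^ a * y ^ b) +
                (r ^ 2 - x ^ 2 - y ^ 2) * ((INR a * x ^ pred a) * y ^ b)) 0.
Proof.
  intros Hr.
  assert (Hb : INR (S b) <> 0) by (apply not_0_INR; lia).
  assert (Hb2 : INR (S (S (S b))) <> 0) by (apply not_0_INR; lia).
  (* With s = [chord r x], u s^(b+1) is the integral of y^b over [-s, s] and K s^(b+3) that of (s^2
     - y^2) y^b. *)
  set (u := (1 - (-1) ^ S b) / INR (S b)).
  set (K := u * 2 / INR (S (S (S b)))).
  set (D := fun x => - 2 * x ^ S a * (u * chord r x ^ S b)
                     + INR a * x ^ pred a * (K * chord r x ^ S (S (S b)))).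
  exists D. split.
  - intros x Hx.
    assert (H1 := is_RInt_pow_sym (chord r x) b).
    assert (H2 := is_RInt_pow_sym (chord r x) (S (S b))).
    apply (is_RInt_ext
      (fun y => (- 2 * x ^ S a + (r ^ 2 - x ^ 2) * (INR a * x ^ pred a)) * y ^ b
                + (- (INR a * x ^ pred a)) * y ^ S (S b))).
    { intros y _. simpl. ring. }
    replace (D x) with
     ((- 2 * x ^ S a + (r ^ 2 - x ^ 2) * (INR a * x ^ pred a)) *
        ((1 - (-1) ^ S b) / (INR (S b)) * chord r x ^ S b) +
      (- (INR a * x ^ pred a)) *
        ((1 - (-1) ^ S (S (S b))) / (INR (S (S (S b)))) * chord r x ^ S (S (S b)))).
    + apply (is_RInt_plus (V := R_NormedModule)); apply (is_RInt_scal (V := R_NormedModule)); assumption.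
    + rewrite <- (chord_sqr r x) by lra. unfold D, K, u. clear H1 H2.
      replace (INR (S (S (S b)))) with (INR (S b) + 2) in * by (rewrite !S_INR; ring).
      change ((-1) ^ S (S (S b))) with (-1 * (-1 * (-1) ^ S b)).
      generalize dependent (INR (S b)). intros q Hq Hq2.
      generalize ((-1) ^ S b). intros e. simpl. field. split; assumption.
  - set (H := fun x => x ^ a * (K * chord r x ^ S (S (S b)))).
    assert (Hend : forall x, x ^ 2 = r ^ 2 -> H x = 0).
    { intros x Hx. unfold H, chord. rewrite Hx, Rminus_diag, sqrt_0. simpl. ring. }
    replace 0 with (H r - H (- r)) by (rewrite (Hend r), (Hend (- r)); ring).
    assert (Hpow : forall x n, continuous (fun x => chord r x ^ n) x).
    { intros x n. apply (continuous_comp (chord r) (fun t => t ^ n)).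
      apply continuous_chord.
      apply (ex_derive_continuous (fun t => t ^ n)). auto_derive; auto. }
    apply (is_RInt_derive_interior H D); [lra | | |].
    + intros x Hx.
      assert (Hs : 0 < chord r x).
      { unfold chord. apply sqrt_lt_R0. nra. }
      assert (Hd := is_derive_chord r x Hx).
      unfold H. auto_derive.
      * exists (- x / chord r x). exact Hd.
      * change (1 * (INR a * x ^ pred a) * (K * chord r x ^ S (S (S b))) +
          x ^ a * (K * (1 * Derive (chord r) x *
            (INR (S (S (S b))) * chord r x ^ S (S b)))) = D x).
        rewrite (is_derive_unique _ _ _ Hd). unfold D, K.
        change (chord r x ^ S (S b)) with (chord r x * chord r x ^ S b).
        change (x ^ S a) with (x * x ^ a).
        field. split; [assumption|lra].
    + intros x. unfold H. apply (continuous_mult (fun x => x ^ a) (fun x => K * chord r x ^ S (S (S b)))).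
      apply (ex_derive_continuous (fun x => x ^ a)). auto_derive; auto.
      apply (continuous_scal_r K (fun x => chord r x ^ S (S (S b)))). apply Hpow.
    + intros x. unfold D.
      apply (continuous_plus (fun x => - 2 * x ^ S a * (u * chord r x ^ S b)) (fun x => INR a * x ^ pred a * (K * chord r x ^ S (S (S b))))).
      * apply (continuous_mult (fun x => - 2 * x ^ S a) (fun x => u * chord r x ^ S b)).
        apply (ex_derive_continuous (fun x => - 2 * x ^ S a)). auto_derive; auto.
        apply (continuous_scal_r u (fun x => chord r x ^ S b)). apply Hpow.
      * apply (continuous_mult (fun x => INR a * x ^ pred a) (fun x => K * chord r x ^ S (S (S b)))).
        apply (ex_derive_continuous (fun x => INR a * x ^ pred a)). auto_derive; auto.
        apply (continuous_scal_r K (fun x => chord r x ^ S (S (S b)))). apply Hpow.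
Qed.

(** * Complex-valued integrals and polynomials in z and zbar *)

(** Testing against every constant [c] records real and imaginary parts together (c = 1 and c = -i)
    and makes complex scaling a mere change of [c]. *)
Definition is_disk_Cint (r : R) (F : C -> C) (v : C) : Prop :=
  forall c : C, is_disk_int r (fun x y => Re (c * F (x, y))) (Re (c * v)).

Lemma is_disk_Cint_ext (r : R) (F G : C -> C) (v w : C) :
  0 <= r -> (forall z, F z = G z) -> v = w ->
  is_disk_Cint r F v -> is_disk_Cint r G w.
Proof.
  intros Hr He <- H c. apply (is_disk_int_ext r (fun x y => Re (c * F (x, y))) _ (Re (c * v))); auto.
  intros x y _ _. now rewrite He.
Qed.

Lemma is_disk_Cint_plus (r : R) (F G : C -> C) (v w : C) :
  0 <= r -> is_disk_Cint r F v -> is_disk_Cint r G w ->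
  is_disk_Cint r (fun z => F z + G z)%C (v + w)%C.
Proof.
  intros Hr H1 H2 c.
  generalize (is_disk_int_plus r _ _ _ _ (H1 c) (H2 c)).
  apply is_disk_int_ext; auto; intros; simpl; ring.
Qed.

Lemma is_disk_Cint_scal (r : R) (k : C) (F : C -> C) (v : C) :
  0 <= r -> is_disk_Cint r F v -> is_disk_Cint r (fun z => k * F z)%C (k * v)%C.
Proof.
  intros Hr H c. generalize (H (c * k)%C).
  apply is_disk_int_ext; auto; intros; f_equal; ring.
Qed.

Lemma is_disk_Cint_real (r : R) (g : C -> R) (v : R) :
  0 <= r -> is_disk_int r (fun x y => g (x, y)) v ->
  is_disk_Cint r (fun z => RtoC (g z)) (RtoC v).
Proof.
  intros Hr H c. generalize (is_disk_int_scal r (Re c) _ _ H).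
  apply is_disk_int_ext; auto; intros; unfold Re; simpl; ring.
Qed.

(* [poly2 F Fx Fy]: F is a complex polynomial in (x, y) with partial derivatives Fx, Fy. *)
Inductive poly2 : (C -> C) -> (C -> C) -> (C -> C) -> Prop :=
| poly2_mono (c : C) (a b : nat) :
    poly2 (fun z => c * RtoC (fst z ^ a * snd z ^ b))%C
          (fun z => c * RtoC (INR a * fst z ^ pred a * snd z ^ b))%C
          (fun z => c * RtoC (fst z ^ a * (INR b * snd z ^ pred b)))%C
| poly2_plus F Fx Fy G Gx Gy : poly2 F Fx Fy -> poly2 G Gx Gy ->
    poly2 (fun z => F z + G z)%C (fun z => Fx z + Gx z)%C (fun z => Fy z + Gy z)%C
| poly2_ext F Fx Fy G Gx Gy : poly2 F Fx Fy ->
    (forall z, F z = G z) -> (forall z, Fx z = Gx z) -> (forall z, Fy z = Gy z) ->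
    poly2 G Gx Gy.

Lemma INR_mul_pow_pred (x : R) (a : nat) : x * (INR a * x ^ pred a) = INR a * x ^ a.
Proof. destruct a; simpl pred; [simpl | rewrite <- tech_pow_Rmult]; ring. Qed.

(** Product rule for a linear factor u x + v y. With (u, v) = (1, i) or (1, -i) the factor is z or
    zbar, so iterating it from the constant 1 produces every z^j zbar^k. *)
Lemma poly2_mul_lin (u v : C) F Fx Fy : poly2 F Fx Fy ->
  poly2 (fun z => (u * RtoC (fst z) + v * RtoC (snd z)) * F z)%C
        (fun z => u * F z + (u * RtoC (fst z) + v * RtoC (snd z)) * Fx z)%C
        (fun z => v * F z + (u * RtoC (fst z) + v * RtoC (snd z)) * Fy z)%C.
Proof.
  induction 1 as [c a b|F Fx Fy G Gx Gy _ IHF _ IHG|F Fx Fy G Gx Gy _ IHF E Ex Ey].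
  - apply (poly2_ext _ _ _ _ _ _ (poly2_plus _ _ _ _ _ _
      (poly2_mono (u * c) (S a) b) (poly2_mono (v * c) a (S b)))); intros [x y];
    cbn [fst snd pred]; rewrite ?S_INR, ?RtoC_mult, ?RtoC_plus, ?RtoC_pow, ?Cpow_S.
    + ring.
    + generalize (f_equal RtoC (INR_mul_pow_pred x a)); rewrite !RtoC_mult, !RtoC_pow; intros E.
      transitivity (u * c * y ^ b * (x ^ a + INR a * x ^ a) + v * c * INR a * x ^ pred a * (y * y ^ b))%C; [ring|].
      rewrite <- E. ring.
    + generalize (f_equal RtoC (INR_mul_pow_pred y b)); rewrite !RtoC_mult, !RtoC_pow; intros E.
      transitivity (v * c * x ^ a * (y ^ b + INR b * y ^ b) + u * c * INR b * y ^ pred b * (x * x ^ a))%C; [ring|].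
      rewrite <- E. ring.
  - apply (poly2_ext _ _ _ _ _ _ (poly2_plus _ _ _ _ _ _ IHF IHG)); intros z; ring.
  - apply (poly2_ext _ _ _ _ _ _ IHF); intros z; now rewrite ?E, ?Ex, ?Ey.
Qed.

Lemma C_fst_snd (z : C) : z = (RtoC (fst z) + Ci * RtoC (snd z))%C.
Proof. destruct z as [x y]. apply injective_projections; simpl; ring. Qed.

Lemma Cconj_fst_snd (z : C) : Cconj z = (RtoC (fst z) - Ci * RtoC (snd z))%C.
Proof. destruct z as [x y]. apply injective_projections; simpl; ring. Qed.

Definition pmono (j k : nat) (z : C) : C := (z ^ j * Cconj z ^ k)%C.

Lemma INR_mul_Cpow_pred (z : C) (a : nat) :
  (z * (RtoC (INR a) * z ^ pred a) = RtoC (INR a) * z ^ a)%C.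
Proof. destruct a; simpl pred; [simpl | rewrite Cpow_S]; ring. Qed.

(** The partial derivatives are written as d/dx = d/dz + d/dzbar and d/dy = i (d/dz - d/dzbar). The
    monomial is built one linear factor at a time, first the powers of zbar = x - i y, then those of
    z = x + i y. *)
Lemma poly2_pmono (j k : nat) :
  poly2 (pmono j k)
    (fun z => INR j * pmono (pred j) k z + INR k * pmono j (pred k) z)%C
    (fun z => Ci * (INR j * pmono (pred j) k z - INR k * pmono j (pred k) z))%C.
Proof.
  induction j as [|j IHj].
  - induction k as [|k IHk].
    + apply (poly2_ext _ _ _ _ _ _ (poly2_mono 1 0 0)); intros [x y]; unfold pmono;
      cbn -[RtoC]; rewrite ?RtoC_mult; ring.
    + apply (poly2_ext _ _ _ _ _ _ (poly2_mul_lin 1 (- Ci) _ _ _ IHk)); intros z;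
      unfold pmono; cbn [pred]; replace (RtoC (INR 0)) with (RtoC 0) by reflexivity;
      rewrite ?S_INR, ?RtoC_plus; generalize (INR_mul_Cpow_pred (Cconj z) k);
      rewrite ?Cpow_S;
      replace (1 * fst z + - Ci * snd z)%C with (Cconj z) by (rewrite (Cconj_fst_snd z); ring);
      generalize (Cconj z); intros w E.
      * ring.
      * transitivity (z ^ 0 * (w ^ k + w * (INR k * w ^ pred k)))%C; [ring|].
        rewrite E; ring.
      * transitivity (- Ci * z ^ 0 * (w ^ k + w * (INR k * w ^ pred k)))%C; [ring|].
        rewrite E; ring.
  - apply (poly2_ext _ _ _ _ _ _ (poly2_mul_lin 1 Ci _ _ _ IHj)); intros z;
      unfold pmono; cbn [pred];
      rewrite ?S_INR, ?RtoC_plus; generalize (INR_mul_Cpow_pred z j);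
      rewrite ?Cpow_S; replace (1 * fst z + Ci * snd z)%C with z by (rewrite (C_fst_snd z) at 1; ring);
      generalize (Cconj z); intros w E.
    + ring.
    + transitivity ((z ^ j + z * (INR j * z ^ pred j)) * w ^ k + INR k * z * z ^ j * w ^ pred k)%C; [ring|].
      rewrite E; ring.
    + transitivity (Ci * ((z ^ j + z * (INR j * z ^ pred j)) * w ^ k - INR k * z * z ^ j * w ^ pred k))%C; [ring|].
      rewrite E; ring.
Qed.

(** * Moments of the disk and the area integral of a polynomial *)

Definition weight (r : R) (z : C) : R := r ^ 2 - fst z ^ 2 - snd z ^ 2.

Lemma weight_conj (r : R) (z : C) : RtoC (weight r z) = (RtoC (r ^ 2) - z * Cconj z)%C.
Proof. destruct z as [x y]. apply injective_projections; unfold weight; simpl; ring. Qed.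

(** A divergence theorem without boundary term: the integrands are the x- and y-derivatives of
    [weight r] times [F], and linearity reduces them to the two real monomial identities. *)
Lemma is_disk_Cint_div_poly2 (r : R) F Fx Fy : 0 < r -> poly2 F Fx Fy ->
  is_disk_Cint r (fun z => RtoC (- 2 * fst z) * F z + RtoC (weight r z) * Fx z)%C 0 /\
  is_disk_Cint r (fun z => RtoC (- 2 * snd z) * F z + RtoC (weight r z) * Fy z)%C 0.
Proof.
  intros Hr. assert (Hr' : 0 <= r) by lra.
  induction 1 as [c a b|F Fx Fy G Gx Gy _ [F1 F2] _ [G1 G2]|F Fx Fy G Gx Gy _ [F1 F2] E Ex Ey].
  - split.
    + generalize (is_disk_Cint_scal r c _ _ Hr' (is_disk_Cint_real r
        (fun z => - 2 * fst z * (fst z ^ a * snd z ^ b) +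
                weight r z * ((INR a * fst z ^ pred a) * snd z ^ b)) 0 Hr'
           (is_disk_int_dx_mono r a b Hr))).
      apply is_disk_Cint_ext; [lra| |ring]. intros z. rewrite !RtoC_plus, !RtoC_mult. ring.
    + generalize (is_disk_Cint_scal r c _ _ Hr' (is_disk_Cint_real r
        (fun z => - 2 * snd z * (fst z ^ a * snd z ^ b) +
                weight r z * (fst z ^ a * (INR b * snd z ^ pred b))) 0 Hr'
           (is_disk_int_dy_mono r a b Hr'))).
      apply is_disk_Cint_ext; [lra| |ring]. intros z. rewrite !RtoC_plus, !RtoC_mult. ring.
  - split; [generalize (is_disk_Cint_plus _ _ _ _ _ Hr' F1 G1)
           |generalize (is_disk_Cint_plus _ _ _ _ _ Hr' F2 G2)];
    (apply is_disk_Cint_ext; [lra| |ring]); intros z; ring.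
  - split; [generalize F1|generalize F2];
    (apply is_disk_Cint_ext; [lra| |ring]); intros z; now rewrite ?E, ?Ex, ?Ey.
Qed.

(* Integrates the z-derivative of (r^2 - |z|^2) z^(j+1) zbar^k. *)
Lemma moment_rec_z (r : R) (j k : nat) : 0 < r ->
  is_disk_Cint r
    (fun z => RtoC (INR (S j) * r ^ 2) * pmono j k z
              - RtoC (INR (S j) + 1) * pmono (S j) (S k) z)%C 0.
Proof.
  intros Hr. assert (Hr' : 0 <= r) by lra.
  destruct (is_disk_Cint_div_poly2 r _ _ _ Hr (poly2_pmono (S j) k)) as [H1 H2].
  (* Half the sum of the first identity and -i times the second realizes d/dz = (d/dx - i d/dy)/2;
     the factor 1 + i^2 removes the zbar-derivative of the monomial. *)
  generalize (is_disk_Cint_scal r (/ 2) _ _ Hr' (is_disk_Cint_plus _ _ _ _ _ Hr' H1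
    (is_disk_Cint_scal r (- Ci) _ _ Hr' H2))).
  apply is_disk_Cint_ext; [lra| |ring].
  intros z. rewrite weight_conj. cbn [pred]. unfold pmono.
  assert (Hc := Cconj_fst_snd z).
  transitivity (/ 2 * (- 2 * (fst z - Ci * snd z) * (z ^ S j * Cconj z ^ k)
     + (r ^ 2 - z * Cconj z) *
       ((1 - Ci * Ci) * (INR (S j) * (z ^ j * Cconj z ^ k))
       + (1 + Ci * Ci) * (INR k * (z ^ S j * Cconj z ^ pred k)))))%C.
  { rewrite !RtoC_mult, RtoC_pow. ring. }
  rewrite <- Hc. replace (Ci * Ci)%C with (RtoC (- (1))) by (apply injective_projections; simpl; ring).
  rewrite !Cpow_S, RtoC_mult, RtoC_pow, RtoC_plus, RtoC_opp. field.
Qed.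

(* Integrates the zbar-derivative of (r^2 - |z|^2) z^j zbar^(k+1). *)
Lemma moment_rec_zbar (r : R) (j k : nat) : 0 < r ->
  is_disk_Cint r
    (fun z => RtoC (INR (S k) * r ^ 2) * pmono j k z
              - RtoC (INR (S k) + 1) * pmono (S j) (S k) z)%C 0.
Proof.
  intros Hr. assert (Hr' : 0 <= r) by lra.
  destruct (is_disk_Cint_div_poly2 r _ _ _ Hr (poly2_pmono j (S k))) as [H1 H2].
  generalize (is_disk_Cint_scal r (/ 2) _ _ Hr' (is_disk_Cint_plus _ _ _ _ _ Hr' H1
    (is_disk_Cint_scal r Ci _ _ Hr' H2))).
  apply is_disk_Cint_ext; [lra| |ring].
  intros z. rewrite weight_conj. cbn [pred]. unfold pmono.
  assert (Hc := C_fst_snd z).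
  transitivity (/ 2 * (- 2 * (fst z + Ci * snd z) * (z ^ j * Cconj z ^ S k)
     + (r ^ 2 - z * Cconj z) *
       ((1 + Ci * Ci) * (INR j * (z ^ pred j * Cconj z ^ S k))
       + (1 - Ci * Ci) * (INR (S k) * (z ^ j * Cconj z ^ k)))))%C.
  { rewrite !RtoC_mult, RtoC_pow. ring. }
  rewrite <- Hc. replace (Ci * Ci)%C with (RtoC (- (1))) by (apply injective_projections; simpl; ring).
  rewrite !Cpow_S, RtoC_mult, RtoC_pow, RtoC_plus, RtoC_opp. field.
Qed.

(** Eliminating M_(j+1,k+1) between the two recurrences leaves r^2 (j - k) M_jk = 0, because
    (j+1)(k+2) - (k+1)(j+2) = j - k. *)
Lemma moment_off_diag (r : R) (j k : nat) : 0 < r -> j <> k ->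
  is_disk_Cint r (pmono j k) 0.
Proof.
  intros Hr Hjk. assert (Hr' : 0 <= r) by lra.
  assert (HD : INR j - INR k <> 0).
  { intros H. apply Hjk, INR_eq. lra. }
  assert (Hd : RtoC (r ^ 2 * (INR j - INR k)) <> 0).
  { intros H. apply RtoC_inj in H. apply Rmult_integral in H.
    destruct H; [|auto]. assert (0 < r ^ 2) by nra. lra. }
  generalize (is_disk_Cint_scal r (/ RtoC (r ^ 2 * (INR j - INR k))) _ _ Hr'
   (is_disk_Cint_plus _ _ _ _ _ Hr'
    (is_disk_Cint_scal r (RtoC (INR (S k) + 1)) _ _ Hr' (moment_rec_z r j k Hr))
    (is_disk_Cint_scal r (RtoC (- (INR (S j) + 1))) _ _ Hr' (moment_rec_zbar r j k Hr)))).
  apply is_disk_Cint_ext; [lra| |ring].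
  intros z. rewrite !S_INR.
  rewrite ?RtoC_opp, ?RtoC_mult, ?RtoC_minus, ?RtoC_plus in *.
  assert (RtoC (INR j) - RtoC (INR k) <> 0)%C by (rewrite <- RtoC_minus; intros H; apply HD, RtoC_inj, H).
  assert (RtoC (r ^ 2) <> 0)%C.
  { intros H1; apply Hd; rewrite H1; ring. }
  field. auto.
Qed.

(** The recurrence M_(j+1,j+1) = r^2 (j+1)/(j+2) M_jj starts from the area pi r^2 of the disk. *)
Lemma moment_diag (r : R) (j : nat) : 0 < r ->
  is_disk_Cint r (pmono j j) (RtoC (PI * r ^ (2 * S j) / INR (S j))).
Proof.
  intros Hr. assert (Hr' : 0 <= r) by lra. induction j as [|j IHj].
  - generalize (is_disk_Cint_real r (fun _ => 1) _ Hr' (is_disk_int_one r Hr')).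
    apply is_disk_Cint_ext; [lra| |].
    + intros z. unfold pmono. simpl. ring.
    + f_equal. simpl. field.
  - assert (Hj : INR (S (S j)) <> 0) by (apply not_0_INR; lia).
    assert (Hj1 : INR (S j) <> 0) by (apply not_0_INR; lia).
    generalize (is_disk_Cint_plus _ _ _ _ _ Hr'
      (is_disk_Cint_scal r (RtoC (INR (S j) * r ^ 2 / INR (S (S j)))) _ _ Hr' IHj)
      (is_disk_Cint_scal r (RtoC (- / INR (S (S j)))) _ _ Hr' (moment_rec_z r j j Hr))).
    apply is_disk_Cint_ext; [lra| |].
    + intros z. rewrite (S_INR (S j)) in *.
      unfold Rdiv. rewrite RtoC_opp, !RtoC_mult, RtoC_inv by assumption.
      field. intros H; apply Hj, RtoC_inj, H.
    + rewrite Cmult_0_r, Cplus_0_r, <- RtoC_mult. f_equal.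
      replace (2 * S (S j))%nat with (2 + 2 * S j)%nat by lia. rewrite pow_add.
      field. auto.
Qed.

(** Orthogonality of the powers of z: adding the term q to the partial sum p gives |p + q|^2 = |p|^2
    + |q|^2 + 2 Re(p conj q), and the cross term integrates to 0 by the off-diagonal moments. *)
Lemma is_disk_int_sqr_poly (r : R) (c : nat -> C) (N : nat) : 0 < r ->
  is_disk_int r (fun x y => Cmod (sum_n (fun n => c n * (x, y) ^ n)%C N) ^ 2)
    (PI * sum_n (fun n => Cmod (c n) ^ 2 * r ^ (2 * S n) / INR (S n)) N).
Proof.
  intros Hr. assert (Hr' : 0 <= r) by lra.
  assert (Hsum : forall (b : nat -> C) M, sum_n b (S M) = (sum_n b M + b (S M))%C).
  { intros. now rewrite sum_Sn. }
  assert (Hdiag : forall n, is_disk_Cint r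
    (fun z => (c n * z ^ n) * Cconj (c n * z ^ n))%C
    (RtoC (PI * (Cmod (c n) ^ 2 * r ^ (2 * S n) / INR (S n))))).
  { intros n. generalize (is_disk_Cint_scal r (c n * Cconj (c n)) _ _ Hr' (moment_diag r n Hr)).
    apply is_disk_Cint_ext; [lra| |].
    - intros z. unfold pmono. rewrite Cmult_conj, Cpow_conj. ring.
    - rewrite <- Cmod2_conj, <- RtoC_mult. f_equal. field. apply not_0_INR; lia. }
  assert (Hcross : forall n M, (M < n)%nat -> is_disk_Cint r
    (fun z => (sum_n (fun n => c n * z ^ n)%C M) * Cconj (c n * z ^ n))%C 0).
  { intros n M. induction M as [|M IHM]; intros HM.
    - generalize (is_disk_Cint_scal r (c 0%nat * Cconj (c n)) _ _ Hr' (moment_off_diag r 0 n Hr ltac:(lia))).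
      apply is_disk_Cint_ext; [lra| |ring].
      intros z. rewrite sum_O. unfold pmono. rewrite Cmult_conj, Cpow_conj. ring.
    - generalize (is_disk_Cint_plus _ _ _ _ _ Hr' (IHM ltac:(lia))
       (is_disk_Cint_scal r (c (S M) * Cconj (c n)) _ _ Hr' (moment_off_diag r (S M) n Hr ltac:(lia)))).
      apply is_disk_Cint_ext; [lra| |ring].
      intros z. rewrite Hsum. unfold pmono. rewrite !Cmult_conj, Cpow_conj. ring. }
  induction N as [|N IHN].
  - rewrite sum_O. generalize (Hdiag 0%nat 1%C).
    apply is_disk_int_ext; [lra| |].
    + intros x y _ _. rewrite sum_O, <- Cmod2_conj, Cmult_1_l. reflexivity.
    + rewrite Cmult_1_l. reflexivity.
  (* The test constants 1 and 2 select |q|^2 and 2 Re(p conj q). *)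
  - rewrite sum_Sn. generalize (is_disk_int_plus _ _ _ _ _
      (is_disk_int_plus _ _ _ _ _ IHN (Hdiag (S N) 1%C)) (Hcross (S N) N ltac:(lia) 2%C)).
    apply is_disk_int_ext; [lra| |].
    + intros x y _ _. rewrite Hsum.
      generalize (sum_n (fun n => c n * (x, y) ^ n)%C N) (c (S N) * (x, y) ^ S N)%C.
      intros [p q] [s t]. rewrite !Cmod2_alt. simpl. ring.
    + rewrite Cmult_1_l, Cmult_0_r. unfold plus; simpl. ring.
Qed.

(** * Uniform limits of disk integrals *)

Lemma is_RInt_uniform_limit (g : nat -> R -> R) (g0 : R -> R) (v e : nat -> R) (a b : R) :
  a <= b ->
  (forall n, is_RInt (g n) a b (v n)) ->
  (forall n x, a <= x <= b -> Rabs (g n x - g0 x) <= e n) ->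
  is_lim_seq e 0 ->
  exists v0, is_RInt g0 a b v0 /\ is_lim_seq v v0.
Proof.
  intros Hab Hg He Hlim.
  (* [filterlim_RInt] asks for uniform convergence on the whole line, so all functions are composed
     with the retraction [c] onto [a, b]. *)
  set (c := fun x => Rmax a (Rmin b x)).
  assert (Hc : forall x, a <= c x <= b).
  { intros x. unfold c. split; [apply Rmax_l|]. apply Rmax_lub; [exact Hab|apply Rmin_l]. }
  assert (Hc' : forall x, a <= x <= b -> c x = x).
  { intros x Hx. unfold c. rewrite Rmin_right, Rmax_right by lra. reflexivity. }
  destruct (filterlim_RInt (V := R_CompleteNormedModule) (fun n x => g n (c x)) a b
    eventually _ (fun x => g0 (c x)) v) as [v0 [H1 H2]].
  - intros n. apply (is_RInt_ext (g n)); [|apply Hg].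
    rewrite Rmin_left, Rmax_right by lra. intros x Hx. rewrite Hc' by lra. reflexivity.
  - apply filterlim_locally. intros eps.
    apply is_lim_seq_spec in Hlim. destruct (Hlim eps) as [N HN].
    exists N. intros n Hn x. specialize (HN n Hn). rewrite Rminus_0_r in HN.
    apply Rle_lt_trans with (2 := HN). apply Rle_trans with (2 := Rle_abs _).
    apply (He n (c x)). apply Hc.
  - exists v0. split; [|exact H1].
    apply (is_RInt_ext (fun x => g0 (c x))); [|exact H2].
    rewrite Rmin_left, Rmax_right by lra. intros x Hx. rewrite Hc' by lra. reflexivity.
Qed.

(** The limit is passed twice, first in each slice and then in the outer integral, where the slice
    integrals converge uniformly with error 2 r e_n since no chord is longer than 2 r. *)
Lemma is_disk_int_uniform_limit (r : R) (g : nat -> R -> R -> R) (g0 : R -> R -> R)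
    (v e : nat -> R) :
  0 <= r ->
  (forall n, is_disk_int r (g n) (v n)) ->
  (forall n x y, Cmod (x, y) <= r -> Rabs (g n x y - g0 x y) <= e n) ->
  is_lim_seq e 0 ->
  exists v0, is_disk_int r g0 v0 /\ is_lim_seq v v0.
Proof.
  intros Hr Hg He Hlim.
  set (inner := fun (u : R -> R -> R) x => RInt (u x) (- chord r x) (chord r x)).
  assert (Hn : forall n x, - r <= x <= r ->
    is_RInt (g n x) (- chord r x) (chord r x) (inner (g n) x)).
  { intros n x Hx. destruct (Hg n) as [h [A _]].
    apply (RInt_correct (g n x)). exists (h x). now apply A. }
  assert (Hout : forall n, is_RInt (inner (g n)) (- r) r (v n)).
  { intros n. destruct (Hg n) as [h [A B]].
    apply (is_RInt_ext h); [|exact B].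
    rewrite Rmin_left, Rmax_right by lra. intros x Hx.
    symmetry. apply is_RInt_unique. apply A. lra. }
  assert (H0 : forall x, - r <= x <= r ->
    is_RInt (g0 x) (- chord r x) (chord r x) (inner g0 x)).
  { intros x Hx. assert (Hc := chord_ge_0 r x).
    destruct (is_RInt_uniform_limit (fun n => g n x) (g0 x) (fun n => inner (g n) x) e
      (- chord r x) (chord r x)) as [v0 [H _]]; auto; [lra| |].
    - intros n y Hy. apply He. apply chord_in_disk; auto.
    - apply (RInt_correct (g0 x)). now exists v0. }
  destruct (is_RInt_uniform_limit (fun n => inner (g n)) (inner g0) v (fun n => 2 * r * e n) (- r) r)
    as [v0 [H1 H2]]; auto; [lra| | |].
  - intros n x Hx. assert (Hc := chord_ge_0 r x). assert (Hc2 := chord_le r x Hr Hx).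
    assert (Hb := norm_RInt_le_const (V := R_NormedModule) (fun y => minus (g n x y) (g0 x y))
      (- chord r x) (chord r x) (minus (inner (g n) x) (inner g0 x)) (e n) ltac:(lra)).
    assert (0 <= e n).
    { apply Rle_trans with (2 := He n 0 0 ltac:(change (Cmod 0 <= r); rewrite Cmod_0; lra)). apply Rabs_pos. }
    apply Rle_trans with ((chord r x - - chord r x) * e n); [|nra].
    apply Hb.
    + intros y Hy. apply (He n x y). apply chord_in_disk; auto.
    + apply (is_RInt_minus (V := R_NormedModule)); auto.
  - replace (Finite 0) with (Rbar_mult (2 * r) 0) by (simpl; f_equal; ring).
    now apply is_lim_seq_scal_l.
  - exists v0. split; auto. exists (inner g0). auto.
Qed.

(** * Power series and termwise differentiation *)

Lemma Rsum_n_S (u : nat -> R) (N : nat) : sum_n u (S N) = sum_n u N + u (S N) :> R.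
Proof. exact (sum_Sn u N). Qed.

Lemma Csum_n_S (u : nat -> C) (N : nat) : sum_n u (S N) = (sum_n u N + u (S N))%C :> C.
Proof. exact (sum_Sn u N). Qed.

Lemma sum_n_le (u w : nat -> R) (N : nat) :
  (forall n, (n <= N)%nat -> u n <= w n) -> sum_n u N <= sum_n w N.
Proof.
  intros H. induction N as [|N IH].
  - rewrite !sum_O. apply H. lia.
  - rewrite !Rsum_n_S. apply Rplus_le_compat; [apply IH; intros; apply H; lia | apply H; lia].
Qed.

Lemma Cmod_sum_n_le (u : nat -> C) (w : nat -> R) (N : nat) :
  (forall n, (n <= N)%nat -> Cmod (u n) <= w n) -> Cmod (sum_n u N) <= sum_n w N.
Proof.
  intros H. induction N as [|N IH].
  - rewrite !sum_O. apply H. lia.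
  - rewrite !Csum_n_S, ?Rsum_n_S. apply Rle_trans with (1 := Cmod_triangle _ _).
    apply Rplus_le_compat; [apply IH; intros; apply H; lia | apply H; lia].
Qed.

(** The partial sum has a closed form over (1 - q)^2 whose numerator falls short of 1 by q^(N+1) (1
    + (N+1)(1 - q)), which is nonnegative. *)
Lemma sum_n_arith_geom_le (q : R) (N : nat) : 0 <= q < 1 ->
  sum_n (fun n => INR (S n) * q ^ n) N <= / (1 - q) ^ 2.
Proof.
  intros Hq.
  assert (E : sum_n (fun n => INR (S n) * q ^ n) N =
    (1 - INR (S (S N)) * q ^ S N + INR (S N) * q ^ S (S N)) / (1 - q) ^ 2 :> R).
  { induction N as [|N IH].
    - rewrite sum_O. simpl. field. lra.
    - rewrite Rsum_n_S, IH.
      rewrite !S_INR. cbn [pow]. field. lra. }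
  rewrite E. unfold Rdiv. rewrite <- (Rmult_1_l (/ (1 - q) ^ 2)) at 2.
  apply Rmult_le_compat_r.
  - apply Rlt_le, Rinv_0_lt_compat. apply pow_lt. lra.
  - assert (0 <= q ^ S N) by (apply pow_le; lra).
    change (q ^ S (S N)) with (q * q ^ S N). rewrite !S_INR.
    generalize dependent (q ^ S N). intros Q _ HQ.
    assert (0 <= INR N) by apply pos_INR.
    assert (0 <= (INR N + 1) * Q * (1 - q)) by (repeat apply Rmult_le_pos; lra). lra.
Qed.

(* quad_coef q n = n (n + 1) / 2 * q ^ (n - 1) *)
Fixpoint quad_coef (q : R) (n : nat) : R :=
  match n with O => 0 | S m => q * quad_coef q m + INR (S m) * q ^ m end.

(** Each partial sum is q times the previous one plus a sum that is at most 1/(1 - q)^2, and 1/(1 -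
    q)^3 is the fixed point of x = q x + 1/(1 - q)^2. *)
Lemma sum_n_quad_coef_le (q : R) (N : nat) : 0 <= q < 1 ->
  sum_n (quad_coef q) N <= / (1 - q) ^ 3.
Proof.
  intros Hq. set (L := / (1 - q) ^ 2).
  assert (HL : 0 <= L) by (apply Rlt_le, Rinv_0_lt_compat, pow_lt; lra).
  assert (HE : / (1 - q) ^ 3 = q * / (1 - q) ^ 3 + L) by (unfold L; field; lra).
  assert (E : forall M, sum_n (quad_coef q) (S M) =
    q * sum_n (quad_coef q) M + sum_n (fun n => INR (S n) * q ^ n) M :> R).
  { induction M as [|M IH].
    - rewrite Rsum_n_S, !sum_O. simpl. ring.
    - rewrite Rsum_n_S in IH.
      rewrite (Rsum_n_S _ (S M)), (Rsum_n_S (quad_coef q) M), (Rsum_n_S (fun n => INR (S n) * q ^ n) M).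
      change (quad_coef q (S (S M))) with (q * quad_coef q (S M) + INR (S (S M)) * q ^ S M).
      lra. }
  induction N as [|N IH].
  - rewrite sum_O. simpl quad_coef. apply Rlt_le, Rinv_0_lt_compat, pow_lt; lra.
  - rewrite E, HE. apply Rplus_le_compat; [|apply sum_n_arith_geom_le; exact Hq].
    apply Rmult_le_compat_l; [lra|exact IH].
Qed.

Lemma Cmod_pow_sub_le (z w : C) (q : R) (n : nat) :
  Cmod z <= q -> Cmod w <= q ->
  Cmod (w ^ S n - z ^ S n) <= INR (S n) * q ^ n * Cmod (w - z).
Proof.
  intros Hz Hw. assert (Hq := Rle_trans _ _ _ (Cmod_ge_0 z) Hz).
  induction n as [|n IH].
  - replace (w ^ 1 - z ^ 1)%C with (w - z)%C by ring. simpl. lra.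
  - replace (w ^ S (S n) - z ^ S (S n))%C
      with (w * (w ^ S n - z ^ S n) + z ^ S n * (w - z))%C by (rewrite !Cpow_S; ring).
    apply Rle_trans with (1 := Cmod_triangle _ _). rewrite !Cmod_mult, Cmod_pow.
    assert (Cmod z ^ S n <= q ^ S n) by (apply pow_incr; split; [apply Cmod_ge_0|exact Hz]).
    assert (0 <= q ^ n) by (apply pow_le; exact Hq).
    assert (Hd := Cmod_ge_0 (w - z)).
    apply Rle_trans with (q * (INR (S n) * q ^ n * Cmod (w - z)) + q ^ S n * Cmod (w - z)).
    + apply Rplus_le_compat.
      * apply Rmult_le_compat; auto using Cmod_ge_0.
      * apply Rmult_le_compat_r; auto.
    + rewrite (S_INR (S n)). simpl (q ^ S n). lra.
Qed.

(** The first-order Taylor remainder R_n of w^(n+1) at z satisfies R_(n+1) = z R_n + (w - z)(w^(n+1)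
    - z^(n+1)); bounding both terms reproduces the recursion of [quad_coef]. *)
Lemma Cmod_pow_taylor_le (z w : C) (q : R) (n : nat) :
  Cmod z <= q -> Cmod w <= q ->
  Cmod (w ^ S n - z ^ S n - (w - z) * (INR (S n) * z ^ n)) <= quad_coef q n * Cmod (w - z) ^ 2.
Proof.
  intros Hz Hw. assert (Hq := Rle_trans _ _ _ (Cmod_ge_0 z) Hz).
  induction n as [|n IH].
  - replace (w ^ 1 - z ^ 1 - (w - z) * (INR 1 * z ^ 0))%C with (RtoC 0)
      by (simpl; ring). rewrite Cmod_0. simpl. lra.
  - replace (w ^ S (S n) - z ^ S (S n) - (w - z) * (INR (S (S n)) * z ^ S n))%C with
     (z * (w ^ S n - z ^ S n - (w - z) * (INR (S n) * z ^ n)) + (w - z) * (w ^ S n - z ^ S n))%C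
      by (rewrite (S_INR (S n)), RtoC_plus, !Cpow_S; ring).
    apply Rle_trans with (1 := Cmod_triangle _ _). rewrite !Cmod_mult.
    assert (Hd := Cmod_ge_0 (w - z)).
    apply Rle_trans with (q * (quad_coef q n * Cmod (w - z) ^ 2) +
      Cmod (w - z) * (INR (S n) * q ^ n * Cmod (w - z))).
    + apply Rplus_le_compat.
      * apply Rmult_le_compat; auto using Cmod_ge_0.
      * apply Rmult_le_compat_l; auto. apply Cmod_pow_sub_le; auto.
    + change (quad_coef q (S n)) with (q * quad_coef q n + INR (S n) * q ^ n). lra.
Qed.

Definition partial_sum (a : nat -> C) (N : nat) (z : C) : C :=
  sum_n (fun n => a n * z ^ n)%C N.

Definition dcoef (a : nat -> C) (n : nat) : C := (INR (S n) * a (S n))%C.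

(** The bound does not depend on N, so N may go to infinity with w fixed. The constant term cancels
    in the difference, which leaves coefficients bounded by [B]. *)
Lemma partial_sum_taylor_le (a : nat -> C) (B q : R) (z w : C) (N : nat) :
  (forall n, (1 <= n)%nat -> Cmod (a n) <= B) ->
  Cmod z <= q -> Cmod w <= q -> q < 1 ->
  Cmod (partial_sum a (S N) w - partial_sum a (S N) z
        - (w - z) * partial_sum (dcoef a) N z)
  <= B * / (1 - q) ^ 3 * Cmod (w - z) ^ 2.
Proof.
  intros HB Hz Hw Hq1. assert (Hq := Rle_trans _ _ _ (Cmod_ge_0 z) Hz).
  assert (HB0 := Rle_trans _ _ _ (Cmod_ge_0 (a 1%nat)) (HB 1%nat (le_n _))).
  assert (E : (partial_sum a (S N) w - partial_sum a (S N) z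
        - (w - z) * partial_sum (dcoef a) N z)%C =
    sum_n (fun n => a (S n) * (w ^ S n - z ^ S n - (w - z) * (INR (S n) * z ^ n)))%C N).
  { unfold partial_sum, dcoef. induction N as [|N IH].
    - rewrite !Csum_n_S, ?Rsum_n_S, !sum_O. simpl. ring.
    - rewrite (Csum_n_S (fun n => a n * w ^ n)%C (S N)), (Csum_n_S (fun n => a n * z ^ n)%C (S N)),
        (Csum_n_S (fun n => INR (S n) * a (S n) * z ^ n)%C N),
        (Csum_n_S (fun n => a (S n) * (w ^ S n - z ^ S n - (w - z) * (INR (S n) * z ^ n)))%C N), <- IH.
      ring. }
  rewrite E.
  apply Rle_trans with (sum_n (fun n => (B * Cmod (w - z) ^ 2) * quad_coef q n) N).
  - apply Cmod_sum_n_le. intros n _. rewrite Cmod_mult.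
    apply Rle_trans with (B * (quad_coef q n * Cmod (w - z) ^ 2)); [|lra].
    apply Rmult_le_compat; auto using Cmod_ge_0.
    + apply HB; lia.
    + apply Cmod_pow_taylor_le; auto.
  - rewrite (sum_n_mult_l (K := R_Ring)). change (@mult ?A ?x ?y) with (x * y).
    apply Rle_trans with (B * Cmod (w - z) ^ 2 * / (1 - q) ^ 3); [|lra].
    apply Rmult_le_compat_l; [|apply sum_n_quad_coef_le; lra].
    apply Rmult_le_pos; auto. apply pow2_ge_0.
Qed.

Lemma taylor_on_disk_lim (f : C -> C) (a : nat -> C) (z : C) (eps : R) :
  taylor_on_disk f a -> Cmod z < 1 -> 0 < eps ->
  exists N0, forall N, (N0 <= N)%nat -> Cmod (partial_sum a N z - f z) < eps.
Proof.
  intros Hf Hz He. specialize (Hf z Hz). unfold is_pseries, is_series in Hf.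
  apply filterlim_locally_ball_norm with (eps := mkposreal eps He) in Hf.
  destruct Hf as [N0 H]. exists N0. intros N HN. specialize (H N HN).
  unfold ball_norm in H. simpl in H.
  replace (partial_sum a N z - f z)%C with
    (minus (sum_n (fun k : nat => scal (pow_n (z : C_AbsRing) k) (a k : C_NormedModule)) N) (f z)); [exact H|].
  change (minus ?x ?y) with (Cminus x y). f_equal. unfold partial_sum. apply (sum_n_ext (G := C_AbelianMonoid)).
  intros k. apply Cmult_comm.
Qed.

Lemma cderiv_eps (f : C -> C) (z l : C) (eps : R) :
  cderiv f z l -> 0 < eps ->
  exists delta, 0 < delta /\ forall w, Cmod (w - z) < delta ->
    Cmod (f w - f z - (w - z) * l) <= eps * Cmod (w - z).
Proof.
  intros [_ Hd] He.
  specialize (Hd z (fun P H => H) (mkposreal eps He)).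
  destruct Hd as [delta Hdelta]. exists delta. split; [apply cond_pos|].
  intros w Hw. exact (Hdelta w Hw).
Qed.

(** A single auxiliary point w = z + t identifies the limit of the differentiated partial sums with
    f'(z): the difference quotients of f and of its partial sums are both close to the respective
    derivatives, the latter uniformly in N. *)
Lemma partial_sum_deriv_lim (f : C -> C) (a : nat -> C) (B : R) (z l : C) (eps : R) :
  taylor_on_disk f a -> (forall n, (1 <= n)%nat -> Cmod (a n) <= B) ->
  Cmod z < 1 -> cderiv f z l -> 0 < eps ->
  exists N0, forall N, (N0 <= N)%nat -> Cmod (partial_sum (dcoef a) N z - l) < eps.
Proof.
  intros Hf HB Hz Hl He.
  assert (HB0 := Rle_trans _ _ _ (Cmod_ge_0 (a 1%nat)) (HB 1%nat (le_n _))).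
  set (q := (1 + Cmod z) / 2). assert (Hz0 := Cmod_ge_0 z).
  set (K := B * / (1 - q) ^ 3).
  assert (HK : 0 <= K).
  { apply Rmult_le_pos; auto. apply Rlt_le, Rinv_0_lt_compat, pow_lt. unfold q; lra. }
  destruct (cderiv_eps f z l (eps / 4) Hl ltac:(lra)) as [delta [Hdel Hd]].
  (* The four conditions on t make w a point other than z, within the radius [delta] of the
     difference quotient, in the disk |w| <= q, and with Taylor remainder K t^2 at most eps t/4. *)
  assert (Hex : exists t, 0 < t /\ t < delta /\ t <= (1 - Cmod z) / 2 /\ K * t <= eps / 4).
  { set (u := eps / (4 * (K + 1))).
    assert (Hu : 0 < u) by (apply Rdiv_lt_0_compat; lra).
    assert (HKu : (K + 1) * u = eps / 4) by (unfold u; field; lra).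
    exists (Rmin (delta / 2) (Rmin ((1 - Cmod z) / 2) u)).
    assert (H1 := Rmin_l (delta / 2) (Rmin ((1 - Cmod z) / 2) u)).
    assert (H2 := Rmin_r (delta / 2) (Rmin ((1 - Cmod z) / 2) u)).
    assert (H3 := Rmin_l ((1 - Cmod z) / 2) u).
    assert (H4 := Rmin_r ((1 - Cmod z) / 2) u).
    assert (0 < Rmin (delta / 2) (Rmin ((1 - Cmod z) / 2) u)) by (repeat apply Rmin_glb_lt; lra).
    repeat split; try lra. nra. }
  destruct Hex as [t [Ht [Htd [Htq HtK]]]].
  set (w := (z + t)%C).
  assert (Hwz : (w - z)%C = RtoC t) by (unfold w; ring).
  assert (Hwt : Cmod (w - z) = t) by (rewrite Hwz, Cmod_R; apply Rabs_pos_eq; lra).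
  assert (Hwq : Cmod w <= q).
  { unfold w. apply Rle_trans with (1 := Cmod_triangle _ _). rewrite Cmod_R, Rabs_pos_eq; unfold q; lra. }
  assert (Het : 0 < eps * t / 8) by nra.
  destruct (taylor_on_disk_lim f a z (eps * t / 8) Hf Hz Het) as [N1 HN1].
  destruct (taylor_on_disk_lim f a w (eps * t / 8) Hf ltac:(unfold q in Hwq; lra) Het) as [N2 HN2].
  exists (max N1 N2). intros N HN.
  specialize (HN1 (S N) ltac:(lia)). specialize (HN2 (S N) ltac:(lia)).
  specialize (Hd w ltac:(lra)).
  assert (HT := partial_sum_taylor_le a B q z w N HB ltac:(unfold q; lra) Hwq ltac:(unfold q; lra)).
  fold K in HT. rewrite Hwt in Hd, HT.
  apply Rmult_lt_reg_l with t; [exact Ht|].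
  rewrite <- Hwt at 1. rewrite <- Cmod_mult.
  revert HN1 HN2 Hd HT.
  set (A1 := (partial_sum a (S N) z - f z)%C). set (A2 := (partial_sum a (S N) w - f w)%C).
  set (A3 := (f w - f z - (w - z) * l)%C).
  set (A4 := (partial_sum a (S N) w - partial_sum a (S N) z - (w - z) * partial_sum (dcoef a) N z)%C).
  intros HN1 HN2 Hd HT.
  (* [A1] and [A2] are each below eps t/8, [A3] and [A4] at most eps t/4 each, so the total is below
     eps t. *)
  replace ((w - z) * (partial_sum (dcoef a) N z - l))%C with ((A2 - A1) + (A3 - A4))%C
    by (unfold A1, A2, A3, A4; ring).
  apply Rle_lt_trans with (1 := Cmod_triangle _ _).
  assert (G1 := Cmod_triangle A2 (- A1)). assert (G2 := Cmod_triangle A3 (- A4)).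
  rewrite Cmod_opp in G1, G2. unfold Cminus. nra.
Qed.

(** Weierstrass M-test with majorant B (n+1) r^n, of sum [T]; [e N] is its tail after N. The bound
    [T] is kept because squared moduli are integrated later. *)
Lemma partial_sum_deriv_uniform (f df : C -> C) (a : nat -> C) (B r : R) :
  taylor_on_disk f a -> (forall n, (1 <= n)%nat -> Cmod (a n) <= B) ->
  0 <= r < 1 -> (forall z, Cmod z < 1 -> cderiv f z (df z)) ->
  exists (e : nat -> R) (T : R), is_lim_seq e 0 /\ forall N z, Cmod z <= r ->
     Cmod (partial_sum (dcoef a) N z - df z) <= e N /\
     Cmod (partial_sum (dcoef a) N z) <= T.
Proof.
  intros Hf HB Hr Hdf.
  assert (HB0 := Rle_trans _ _ _ (Cmod_ge_0 (a 1%nat)) (HB 1%nat (le_n _))).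
  set (b := fun n => B * (INR (S n) * r ^ n)).
  assert (Hb0 : forall n, 0 <= b n).
  { intros n. apply Rmult_le_pos; auto. apply Rmult_le_pos; [apply pos_INR|apply pow_le; lra]. }
  assert (Hterm : forall z n, Cmod z <= r -> Cmod (dcoef a n * z ^ n) <= b n).
  { intros z n Hz. unfold dcoef, b. rewrite !Cmod_mult, Cmod_pow, Cmod_R, Rabs_pos_eq by apply pos_INR.
    replace (INR (S n) * Cmod (a (S n)) * Cmod z ^ n) with (Cmod (a (S n)) * (INR (S n) * Cmod z ^ n)) by ring.
    apply Rmult_le_compat; auto using Cmod_ge_0.
    - apply Rmult_le_pos; [apply pos_INR|apply pow_le, Cmod_ge_0].
    - apply HB; lia.
    - apply Rmult_le_compat_l; [apply pos_INR|]. apply pow_incr. split; [apply Cmod_ge_0|exact Hz]. }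
  assert (Hincr : forall n, sum_n b n <= sum_n b (S n)).
  { intros n. rewrite Rsum_n_S. specialize (Hb0 (S n)). lra. }
  destruct (ex_finite_lim_seq_incr (sum_n b) (B * / (1 - r) ^ 2)) as [T HT].
  - exact Hincr.
  - intros n. unfold b. rewrite (sum_n_mult_l (K := R_Ring)). change (@mult ?A ?x ?y) with (x * y).
    apply Rmult_le_compat_l; auto. apply sum_n_arith_geom_le; lra.
  - assert (HTn : forall n, sum_n b n <= T) by (intros n; apply (is_lim_seq_incr_compare (sum_n b)); auto).
    exists (fun n => T - sum_n b n), T. split.
    { replace (Finite 0) with (Finite (T - T)) by (f_equal; ring).
      apply is_lim_seq_minus'; [apply is_lim_seq_const|exact HT]. }
    intros N z Hz. split.
    + assert (Htail : forall k, Cmod (partial_sum (dcoef a) (k + N) z - partial_sum (dcoef a) N z)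
        <= sum_n b (k + N) - sum_n b N).
      { induction k as [|k IH].
        - simpl. replace (partial_sum (dcoef a) N z - partial_sum (dcoef a) N z)%C with (RtoC 0) by ring.
          rewrite Cmod_0. lra.
        - change (S k + N)%nat with (S (k + N)). unfold partial_sum at 1. rewrite Csum_n_S, Rsum_n_S.
          fold (partial_sum (dcoef a) (k + N) z).

          replace (partial_sum (dcoef a) (k + N) z + dcoef a (S (k + N)) * z ^ S (k + N) - partial_sum (dcoef a) N z)%C
           with ((partial_sum (dcoef a) (k + N) z - partial_sum (dcoef a) N z) + dcoef a (S (k + N)) * z ^ S (k + N))%C by ring.
          apply Rle_trans with (1 := Cmod_triangle _ _).
          specialize (Hterm z (S (k + N)) Hz). lra. }
      apply le_epsilon. intros eps He.
      destruct (partial_sum_deriv_lim f a B z (df z) eps Hf HB ltac:(lra) (Hdf z ltac:(lra)) He) as [N0 HN0].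
      specialize (HN0 (N0 + N)%nat ltac:(lia)). specialize (Htail N0). specialize (HTn (N0 + N)%nat).
      replace (partial_sum (dcoef a) N z - df z)%C with
        ((partial_sum (dcoef a) (N0 + N) z - df z) + - (partial_sum (dcoef a) (N0 + N) z - partial_sum (dcoef a) N z))%C by ring.
      apply Rle_trans with (1 := Cmod_triangle _ _). rewrite Cmod_opp. lra.
    + apply Rle_trans with (2 := HTn N). apply Cmod_sum_n_le. intros n _. now apply Hterm.
Qed.

(** * Bound for the area *)

(** The area integral of a differentiated partial sum is pi times a sum of terms (n+1) |a_(n+1)|^2
    r^(2n+2), hence at most pi B^2 r^2/(1 - r^2)^2; the bounds pass to the limit S_r. *)
Lemma area_S_le (f df : C -> C) (a : nat -> C) (B r : R) :
  taylor_on_disk f a -> (forall n, (1 <= n)%nat -> Cmod (a n) <= B) ->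
  0 < r < 1 -> (forall z, Cmod z < 1 -> cderiv f z (df z)) ->
  0 <= area_S df r <= PI * (B ^ 2 * (r / (1 - r ^ 2)) ^ 2).
Proof.
  intros Hf HB Hr Hdf.
  destruct (partial_sum_deriv_uniform f df a B r Hf HB ltac:(lra) Hdf) as [e [T [He HeT]]].
  assert (HT0 : 0 <= T).
  { apply Rle_trans with (1 := Cmod_ge_0 (partial_sum (dcoef a) 0 0)).
    apply (HeT 0%nat 0). rewrite Cmod_0. lra. }
  assert (He0 : forall n, 0 <= e n).
  { intros n. apply Rle_trans with (1 := Cmod_ge_0 (partial_sum (dcoef a) n 0 - df 0)).
    apply HeT. rewrite Cmod_0. lra. }
  (* With |p| <= T and |p - d| <= e_N, the squares |p|^2 and |d|^2 differ by at most |p - d| (|p| +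
     |d|) <= e_N (2 T + e_N). *)
  destruct (is_disk_int_uniform_limit r
    (fun N x y => Cmod (partial_sum (dcoef a) N (x, y)) ^ 2)
    (fun x y => Cmod (df (x, y)) ^ 2)
    (fun N => PI * sum_n (fun n => Cmod (dcoef a n) ^ 2 * r ^ (2 * S n) / INR (S n)) N)
    (fun N => e N * (2 * T + e N))) as [v [Hv Hlim]].
  - lra.
  - intros N. apply is_disk_int_sqr_poly. lra.
  - intros N x y Hxy. destruct (HeT N (x, y) Hxy) as [H1 H2].
    set (p := partial_sum (dcoef a) N (x, y)) in *. set (d := df (x, y)) in *.
    assert (Hp := Cmod_ge_0 p). assert (Hd := Cmod_ge_0 d).
    assert (G1 := Cmod_triangle (p - d) d). replace (p - d + d)%C with p in G1 by ring.
    assert (G2 := Cmod_triangle (- (p - d)) p). replace (- (p - d) + p)%C with d in G2 by ring.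
    rewrite Cmod_opp in G2. specialize (He0 N).
    replace (Cmod p ^ 2 - Cmod d ^ 2) with ((Cmod p - Cmod d) * (Cmod p + Cmod d)) by ring.
    rewrite Rabs_mult. apply Rmult_le_compat; try apply Rabs_pos.
    + apply Rabs_le. lra.
    + rewrite Rabs_pos_eq by lra. lra.
  - replace (Finite 0) with (Finite (0 * (2 * T + 0))) by (f_equal; ring).
    apply is_lim_seq_mult'; [exact He|]. apply is_lim_seq_plus'; [apply is_lim_seq_const|exact He].
  - rewrite (is_disk_int_area r df v) by (lra || exact Hv).
    assert (HP := PI_RGT_0).
    assert (Hbd : forall N, 0 <= PI * sum_n (fun n => Cmod (dcoef a n) ^ 2 * r ^ (2 * S n) / INR (S n)) N
       <= PI * (B ^ 2 * (r / (1 - r ^ 2)) ^ 2)).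
    { intros N. assert (Hterm : forall n, 0 <= Cmod (dcoef a n) ^ 2 * r ^ (2 * S n) / INR (S n)
        <= B ^ 2 * r ^ 2 * (INR (S n) * (r ^ 2) ^ n)).
      { intros n. assert (Hn : 0 < INR (S n)) by (apply lt_0_INR; lia).
        unfold dcoef. rewrite Cmod_mult, Cmod_R, Rabs_pos_eq by lra.
        replace ((INR (S n) * Cmod (a (S n))) ^ 2 * r ^ (2 * S n) / INR (S n))
          with (Cmod (a (S n)) ^ 2 * (r ^ 2 * (INR (S n) * (r ^ 2) ^ n))).
        - assert (0 <= r ^ 2 * (INR (S n) * (r ^ 2) ^ n)).
          { apply Rmult_le_pos; [apply pow2_ge_0|]. apply Rmult_le_pos; [lra|].
            apply pow_le, pow2_ge_0. }
          split; [apply Rmult_le_pos; [apply pow2_ge_0|assumption]|].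
          rewrite Rmult_assoc. apply Rmult_le_compat_r; [assumption|].
          apply pow_incr. split; [apply Cmod_ge_0|apply HB; lia].
        - rewrite pow_mult. change ((r ^ 2) ^ S n) with (r ^ 2 * (r ^ 2) ^ n).
          generalize ((r ^ 2) ^ n). intros. field. lra. }
      split.
      - apply Rmult_le_pos; [lra|].
        apply Rle_trans with (sum_n (fun _ => 0) N).
        + rewrite sum_n_const. lra.
        + apply sum_n_le. intros n _. apply Hterm.
      - apply Rmult_le_compat_l; [lra|].
        apply Rle_trans with (sum_n (fun n => B ^ 2 * r ^ 2 * (INR (S n) * (r ^ 2) ^ n)) N).
        + apply sum_n_le. intros n _. apply Hterm.
        + rewrite (sum_n_mult_l (K := R_Ring)). change (@mult ?A ?x ?y) with (x * y).
          assert (r ^ 2 < 1) by nra.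
          replace (B ^ 2 * (r / (1 - r ^ 2)) ^ 2) with (B ^ 2 * r ^ 2 * / (1 - r ^ 2) ^ 2)
            by (field; lra).
          apply Rmult_le_compat_l; [apply Rmult_le_pos; apply pow2_ge_0|].
          apply sum_n_arith_geom_le. split; [apply pow2_ge_0|assumption]. }
    split.
    + apply (is_lim_seq_le (fun _ => 0) _ 0 v (fun N => proj1 (Hbd N)) (is_lim_seq_const 0) Hlim).
    + apply (is_lim_seq_le _ (fun _ => PI * (B ^ 2 * (r / (1 - r ^ 2)) ^ 2)) v _ (fun N => proj2 (Hbd N)) Hlim (is_lim_seq_const _)).
Qed.

(** * Taylor coefficients and lambda *)

Lemma taylor_coef_0 (f : C -> C) (a : nat -> C) : taylor_on_disk f a -> a 0%nat = f 0.
Proof.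
  intros Hf.
  assert (E : forall N, partial_sum a N 0 = a 0%nat).
  { induction N as [|N IH]; unfold partial_sum in *.
    - rewrite sum_O. simpl. ring.
    - rewrite Csum_n_S, IH, Cpow_S. ring. }
  assert (H0 : Cmod (a 0%nat - f 0) = 0).
  { apply Rle_antisym; [|apply Cmod_ge_0]. apply le_epsilon. intros eps He.
    destruct (taylor_on_disk_lim f a 0 eps Hf ltac:(rewrite Cmod_0; lra) He) as [N HN].
    specialize (HN N (le_n _)). rewrite E in HN. lra. }
  apply Cmod_eq_0 in H0. replace (a 0%nat) with (a 0%nat - f 0 + f 0)%C by ring.
  rewrite H0. ring.
Qed.

(** Restriction to the real diameter, followed by the real part of a complex multiple, gives a real
    power series, to which real differentiation theorems apply. *)
Lemma is_pseries_Re (f : C -> C) (a : nat -> C) (c : C) (x : R) :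
  taylor_on_disk f a -> Rabs x < 1 ->
  is_pseries (fun n => Re (c * a n)) x (Re (c * f x)).
Proof.
  intros Hf Hx. apply is_pseries_R.
  assert (E : forall N, sum_n (fun n => Re (c * a n) * x ^ n) N = Re (c * partial_sum a N x) :> R).
  { assert (T : forall n, Re (c * a n) * x ^ n = Re (c * (a n * RtoC x ^ n))).
    { intros n. rewrite <- RtoC_pow. unfold Re. simpl. ring. }
    induction N as [|N IH]; unfold partial_sum in *.
    - rewrite !sum_O. apply T.
    - rewrite Rsum_n_S, Csum_n_S, IH, T. unfold Re. simpl. ring. }
  unfold is_series. apply filterlim_locally. intros eps.
  assert (Hc := Cmod_ge_0 c).
  assert (He : 0 < eps / (Cmod c + 1)) by (apply Rdiv_lt_0_compat; [apply cond_pos|lra]).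
  destruct (taylor_on_disk_lim f a x _ Hf ltac:(rewrite Cmod_R; exact Hx) He) as [N0 H].
  exists N0. intros N HN. rewrite E.
  change (Rabs (Re (c * partial_sum a N x) - Re (c * f x)) < eps).
  replace (Re (c * partial_sum a N x) - Re (c * f x)) with (Re (c * (partial_sum a N x - f x)))
    by (unfold Re; simpl; ring).
  apply Rle_lt_trans with (1 := re_le_Cmod _). rewrite Cmod_mult.
  specialize (H N HN). assert (Hp := Cmod_ge_0 (partial_sum a N x - f x)).
  apply Rle_lt_trans with ((Cmod c + 1) * Cmod (partial_sum a N x - f x)); [lra|].
  replace (pos eps) with ((Cmod c + 1) * (eps / (Cmod c + 1))) by (field; lra).
  apply Rmult_lt_compat_l; [lra|exact H].
Qed.

(** With c the conjugate of a_n, the real series with coefficients Re(c a_k) is constant on (-1, 1),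
    so its n-th derivative at 0 vanishes; its n-th coefficient is |a_n|^2. *)
Lemma taylor_coef_const (f : C -> C) (a : nat -> C) (v : C) :
  taylor_on_disk f a -> (forall z, Cmod z < 1 -> f z = v) ->
  forall n, (1 <= n)%nat -> a n = 0.
Proof.
  intros Hf Hv n Hn. set (c := Cconj (a n)). set (b := fun k => Re (c * a k)).
  assert (Hps : forall x, Rabs x < 1 -> is_pseries b x (Re (c * v))).
  { intros x Hx. rewrite <- (Hv x) by (now rewrite Cmod_R). now apply is_pseries_Re. }
  assert (Hrad : Rbar_lt 0 (CV_radius b)).
  { assert (Habs : Rabs (/ 2) < 1) by (rewrite Rabs_pos_eq; lra).
    apply Rbar_lt_le_trans with (Rabs (/ 2)); [simpl; rewrite Rabs_pos_eq; lra|].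
    apply Rbar_not_lt_le. intros H. apply (CV_disk_outside _ _ H).
    apply ex_series_lim_0. exists (Re (c * v)). apply is_pseries_R. now apply Hps. }
  assert (H := Derive_n_coef b n Hrad).
  rewrite (Derive_n_ext_loc (PSeries b) (fun _ => Re (c * v))) in H.
  - destruct n as [|n]; [lia|]. rewrite Derive_n_const in H.
    symmetry in H. apply Rmult_integral in H. destruct H as [H|H]; [|apply INR_fact_neq_0 in H; contradiction].
    unfold b, c in H. rewrite Cmult_comm, <- Cmod2_conj in H.
    change (Cmod (a (S n)) ^ 2 = 0) in H.
    apply Cmod_eq_0. generalize (Cmod_ge_0 (a (S n))). intros. nra.
  - exists (mkposreal 1 Rlt_0_1). intros x Hx. apply is_pseries_unique, Hps.
    rewrite <- (Rminus_0_r x). exact Hx.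
Qed.

(** A nonconstant f puts |a_n|/(1 - |a_0|^2) in the set whose least upper bound is lambda. A
    constant f contributes nothing to that set, but its coefficients with n >= 1 vanish. *)
Lemma taylor_coef_le (Omega : C -> Prop) (lam : R) (f : C -> C) (a : nat -> C) :
  (forall z, Cmod z < 1 -> Omega z) -> is_lambda Omega lam -> 0 < lam ->
  in_B Omega f -> taylor_on_disk f a ->
  Cmod (a 0%nat) < 1 /\
  forall n, (1 <= n)%nat -> Cmod (a n) <= lam * (1 - Cmod (a 0%nat) ^ 2).
Proof.
  intros HD [Hub _] Hlam HB Hf.
  assert (H0 : Cmod (a 0%nat) < 1).
  { rewrite (taylor_coef_0 f a Hf). apply HB, HD. rewrite Cmod_0. lra. }
  assert (Hd : 0 < 1 - Cmod (a 0%nat) ^ 2) by (generalize (Cmod_ge_0 (a 0%nat)); intros; nra).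
  split; [exact H0|]. intros n Hn.
  destruct (Classical_Prop.classic (nonconstant_on Omega f)) as [Hnc|Hc].
  - apply (Rmult_le_reg_r (/ (1 - Cmod (a 0%nat) ^ 2))); [now apply Rinv_0_lt_compat|].
    rewrite Rmult_assoc, Rinv_r, Rmult_1_r by lra.
    apply Hub. exists f, a, n. auto.
  - rewrite (taylor_coef_const f a (f 0) Hf); [rewrite Cmod_0; nra| |exact Hn].
    intros z Hz. apply Classical_Prop.NNPP. intros Hne. apply Hc.
    exists z, 0. repeat split; auto. apply HD. rewrite Cmod_0. lra.
Qed.

(** * Majorant series, the polynomial P and the final estimate *)

Lemma Series_dominated_le (u : nat -> R) (B r : R) :
  (forall n, 0 <= u n) -> (forall n, (1 <= n)%nat -> u n <= B) -> 0 <= r < 1 ->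
  Series (fun n => u n * r ^ n) <= u 0%nat + B * (r / (1 - r)).
Proof.
  intros Hu HB Hr.
  assert (Hterm : forall n, 0 <= u (S n) * r ^ S n <= (B * r) * r ^ n).
  { intros n. assert (0 <= r ^ n) by (apply pow_le; lra).
    assert (0 <= r * r ^ n) by nra. specialize (HB (S n) ltac:(lia)). specialize (Hu (S n)).
    simpl (r ^ S n). nra. }
  assert (Hrabs : Rabs r < 1) by (rewrite Rabs_pos_eq; lra).
  assert (Hgeom : ex_series (fun n => (B * r) * r ^ n)).
  { apply (ex_series_scal_l (B * r) (fun n => r ^ n)). now apply ex_series_geom. }
  rewrite Series_incr_1.
  - simpl (r ^ 0). rewrite Rmult_1_r. apply Rplus_le_compat_l.
    apply Rle_trans with (1 := Series_le _ _ Hterm Hgeom).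
    rewrite Series_scal_l, Series_geom by exact Hrabs. apply Req_le. field. lra.
  - apply ex_series_incr_1.
    apply (ex_series_le (V := R_CompleteNormedModule)) with (2 := Hgeom).
    intros n. apply Rle_trans with (2 := proj2 (Hterm n)).
    apply Req_le. apply (Rabs_pos_eq (u (S n) * r ^ S n)), Hterm.
Qed.

(** The j-th term is (c^2 w)^j with c = (1 + lam)/(1 + 2 lam), at most x^j; the geometric sum
    starting at j = 1 is at most x/(1 - x) for every m. *)
Lemma Ppoly_le (lam : R) (m : nat) (w x : R) :
  0 <= w -> ((1 + lam) / (1 + 2 * lam)) ^ 2 * w <= x -> x < 1 ->
  Ppoly lam m w <= x / (1 - x).
Proof.
  intros Hw Hx Hx1. set (c := (1 + lam) / (1 + 2 * lam)) in *.
  assert (Hcw : 0 <= c ^ 2 * w) by (apply Rmult_le_pos; [apply pow2_ge_0|exact Hw]).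
  unfold Ppoly, sum_f. fold c. set (M := (m - 1)%nat).
  (* [sum_f 1 m] is a sum over i <= m - 1 with j = i + 1, hence the majorant x^i x. *)
  apply Rle_trans with (sum_f_R0 (fun i => x ^ i * x) M).
  - apply sum_Rle. intros n _. rewrite pow_mult, <- Rpow_mult_distr, Nat.add_1_r.
    rewrite (Rmult_comm (x ^ n)), tech_pow_Rmult. apply pow_incr. lra.
  - rewrite <- scal_sum, tech3 by lra.
    unfold Rdiv. rewrite <- Rmult_assoc. apply Rmult_le_compat_r.
    + apply Rlt_le, Rinv_0_lt_compat. lra.
    + assert (0 <= x ^ S M) by (apply pow_le; lra). nra.
Qed.

Theorem theorem2p3 (Omega : C -> Prop) (lam : R) (m : nat)
  (f : C -> C) (a : nat -> C) (df : C -> C) :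
  is_domain Omega -> simply_connected Omega ->
  (forall z : C, Cmod z < 1 -> Omega z) ->
  is_lambda Omega lam -> 0 < lam ->
  (1 <= m)%nat ->
  in_B Omega f ->
  taylor_on_disk f a ->
  (forall z, Omega z -> cderiv f z (df z)) ->
  (forall r, 0 < r <= 1 / (1 + 2 * lam) ->
     Series (fun n => Cmod (a n) * r ^ n) + Ppoly lam m (area_S df r / PI) <= 1)
  /\
  (Series (fun n => Cmod (a n) * (1 / (1 + 2 * lam)) ^ n)
     + Ppoly lam m (area_S df (1 / (1 + 2 * lam)) / PI) = 1 ->
   exists c : C, Cmod c = 1 /\ forall z, Omega z -> f z = c).
Proof.
  intros _ _ HD Hl Hlam _ HB Hf Hdf.
  destruct (taylor_coef_le Omega lam f a HD Hl Hlam HB Hf) as [HA1 Hcoef].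
  assert (HA0 := Cmod_ge_0 (a 0%nat)). set (A := Cmod (a 0%nat)) in *.
  set (d := 1 - A ^ 2) in *. assert (Hd : 0 < d) by (unfold d; nra).
  assert (Hstrict : forall r, 0 < r <= 1 / (1 + 2 * lam) ->
     Series (fun n => Cmod (a n) * r ^ n) + Ppoly lam m (area_S df r / PI) < 1).
  { intros r [Hr0 Hr].
    assert (HrL : r * (1 + 2 * lam) <= 1).
    { apply (Rmult_le_compat_r (1 + 2 * lam)) in Hr; [|lra].
      replace (1 / (1 + 2 * lam) * (1 + 2 * lam)) with 1 in Hr by (field; lra). exact Hr. }
    assert (Hr1 : r < 1) by nra.
    assert (HS : Series (fun n => Cmod (a n) * r ^ n) <= A + d / 2).
    { apply Rle_trans with (A + lam * d * (r / (1 - r))).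
      - apply (Series_dominated_le (fun n => Cmod (a n))); auto using Cmod_ge_0. lra.
      - apply Rplus_le_compat_l.
        (* The condition r (1 + 2 lam) <= 1 is the same as lam r <= (1 - r)/2. *)
        assert (lam * (r / (1 - r)) <= / 2).
        { apply (Rmult_le_reg_r (1 - r)); [lra|].
          replace (lam * (r / (1 - r)) * (1 - r)) with (lam * r) by (field; lra). lra. }
        nra. }
    destruct (area_S_le f df a (lam * d) r Hf Hcoef ltac:(lra) ltac:(auto)) as [Ha0 Ha].
    assert (HP := PI_RGT_0).
    set (w := area_S df r / PI).
    assert (Hw0 : 0 <= w) by (apply Rdiv_le_0_compat; lra).
    assert (Hw : w <= (lam * d) ^ 2 * (r / (1 - r ^ 2)) ^ 2).
    { apply (Rmult_le_reg_l PI); [exact HP|]. unfold w.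
      replace (PI * (area_S df r / PI)) with (area_S df r) by (field; lra). exact Ha. }
    assert (Hr2 : 0 < 1 - r ^ 2) by nra.
    (* The weights are k_j = c^(2j); at the largest radius 1/(1 + 2 lam) the quantity c lam r/(1 -
       r^2) equals 1/4, the source of the constant 16 below. *)
    set (c := (1 + lam) / (1 + 2 * lam)).
    assert (Hq0 : 0 <= c * lam * (r / (1 - r ^ 2))).
    { repeat apply Rmult_le_pos; try lra; apply Rlt_le, Rinv_0_lt_compat; lra. }
    (* after clearing denominators: (r (1 + 2 lam) - 1) (1 + 2 lam + r) <= 0 *)
    assert (Hq : c * lam * (r / (1 - r ^ 2)) <= / 4).
    { apply (Rmult_le_reg_r (4 * (1 + 2 * lam) * (1 - r ^ 2))); [nra|].
      replace (c * lam * (r / (1 - r ^ 2)) * (4 * (1 + 2 * lam) * (1 - r ^ 2)))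
        with (4 * (1 + lam) * lam * r) by (unfold c; field; lra).
      assert ((1 - r * (1 + 2 * lam)) * (1 + 2 * lam + r) >= 0).
      { apply Rle_ge, Rmult_le_pos; lra. }
      lra. }
    assert (Hcw : c ^ 2 * w <= d ^ 2 / 16).
    { apply Rle_trans with (c ^ 2 * ((lam * d) ^ 2 * (r / (1 - r ^ 2)) ^ 2)).
      - apply Rmult_le_compat_l; [apply pow2_ge_0|exact Hw].
      - replace (c ^ 2 * ((lam * d) ^ 2 * (r / (1 - r ^ 2)) ^ 2))
          with (d ^ 2 * (c * lam * (r / (1 - r ^ 2))) ^ 2) by ring.
        assert ((c * lam * (r / (1 - r ^ 2))) ^ 2 <= (/ 4) ^ 2) by (apply pow_incr; lra).
        assert (0 <= d ^ 2) by apply pow2_ge_0. nra. }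
    assert (Hd1 : d <= 1) by (unfold d; nra).
    assert (Hd2 : d ^ 2 <= 1) by nra.
    assert (Hpol := Ppoly_le lam m w (d ^ 2 / 16) Hw0 Hcw ltac:(lra)).
    (* Since d <= 1, the denominator 1 - d^2/16 is at least 15/16. *)
    assert (Hgeo : d ^ 2 / 16 / (1 - d ^ 2 / 16) <= d ^ 2 / 15).
    { apply (Rmult_le_reg_r (1 - d ^ 2 / 16)); [lra|].
      replace (d ^ 2 / 16 / (1 - d ^ 2 / 16) * (1 - d ^ 2 / 16)) with (d ^ 2 / 16) by (field; lra).
      assert (0 <= d ^ 2) by apply pow2_ge_0. nra. }
    (* 1 - A - d/2 = (1 - A)^2/2, whereas d^2 = (1 - A)^2 (1 + A)^2 <= 4 (1 - A)^2 *)
    assert (Hfin : d ^ 2 / 15 < 1 - A - d / 2).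
    { replace (d ^ 2) with ((1 - A) ^ 2 * (1 + A) ^ 2) by (unfold d; ring).
      replace (1 - A - d / 2) with ((1 - A) ^ 2 / 2) by (unfold d; field).
      assert (0 < (1 - A) ^ 2) by (apply pow_lt; lra).
      assert ((1 + A) ^ 2 <= 4) by nra. nra. }
    lra. }
  split.
  - intros r Hr. now apply Rlt_le, Hstrict.
  - intros E. exfalso. apply (Rlt_not_eq _ _ (Hstrict (1 / (1 + 2 * lam))
      (conj (Rdiv_lt_0_compat 1 (1 + 2 * lam) ltac:(lra) ltac:(lra)) (Rle_refl _))) E).
Qed.
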